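(* Let $\mathbb{B}\subset\mathbb{M}\subseteq\mathbb{N}$, let $m\in\mathbb{N}$, and suppose that $\mathcal{C}(m,\mathbb{B})\neq\emptyset$ and $\mathcal{C}(m+t,\mathbb{B})\neq\emptyset$ for some integer $t\geq 4$. Suppose that there exists an axis $\mathbb{L}_{[x],[y]}$ of $\mathcal{C}(m+t,\mathbb{M})$ (that is, $x,y\in\mathbb{M}$ with $x+y=m+t$) with $x\in\mathbb{B}$ and $x<y$ such that $$y>w>m-x,\qquad\text{where } w=\max\{u\in\Vert\mathcal{C}(m,\mathbb{M})\Vert \mid u\in\mathbb{B}\}.$$ Then there exists a generator $s\in\mathbb{N}$ with $m<s<m+t$ such that $\mathcal{C}(s,\mathbb{B})\neq\emptyset$.
   Context: $\mathbb{N}=\{1,2,3,\dots\}$. For $n\in\mathbb{N}$ and $\mathbb{M}\subseteq\mathbb{N}$, the circle of partition with generator $n$ and base set $\mathbb{M}$ is $\mathcal{C}(n,\mathbb{M})=\{[x]\mid x\in\mathbb{M},\ n-x\in\mathbb{M}\}$. The weight of a point $[x]$ is $\Vert[x]\Vert:=x$, and $\Vert\mathcal{C}(n,\mathbb{M})\Vert=\{x\mid [x]\in\mathcal{C}(n,\mathbb{M})\}$ is the set of weights. An axis $\mathbb{L}_{[x],[y]}$ of $\mathcal{C}(n,\mathbb{M})$ is a pair of points $[x],[y]\in\mathcal{C}(n,\mathbb{M})$ with $x+y=n$. *)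

(* Defs.v *)
From mathcomp Require Import all_boot all_order all_algebra.
From mathcomp Require Import boolp classical_sets.

Set Implicit Arguments.
Unset Strict Implicit.
Unset Printing Implicit Defensive.

Local Open Scope classical_set_scope.

(* The natural numbers 1, 2, 3, ... as a subset of nat. *)
Definition posN : set nat := [set n | 0 < n].

(* The point [x] of a circle of partition; its weight is x. *)
Record cpoint : Type := Point { weight : nat }.

(* The conjunct x <= n ensures that the truncated n - x is the true difference. *)
Definition circle (n : nat) (M : set nat) : set cpoint :=
  [set Point x | x in [set x | [/\ M x, x <= n & M (n - x)]]].

Definition weights (C : set cpoint) : set nat := weight @` C.

Definition is_axis (n : nat) (M : set nat) (p q : cpoint) : Prop :=
  [/\ circle n M p, circle n M q & weight p + weight q = n].

Definition is_max (A : set nat) (w : nat) : Prop := A w /\ ubound A w.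

(* Main.v *)
Require Import Defs.
From mathcomp Require Import all_boot all_order all_algebra.
From mathcomp Require Import boolp classical_sets.
From mathcomp Require Import zify.

Local Open Scope classical_set_scope.

(** The generator is [s = x + w]. Both [x] and [w] lie in [B], so they form an
    axis of the circle of generator [x + w] over [B]; and the hypothesis
    [m - x < w < y] is exactly [m < x + w < x + y = m + t]. *)

Lemma circle_add_nonempty (B : set nat) (a b : nat) :
  B a -> B b -> circle (a + b) B !=set0.
Proof.
move=> Ba Bb; exists (Point a), a => //.
by split; rewrite ?leq_addr ?addKn.
Qed.

Theorem theorem3p1 (B M : set nat) (m t : nat)
    (BM : B `<` M) (MN : M `<=` posN) (mN : posN m) (t_ge4 : 4 <= t)
    (CmB : circle m B !=set0) (CmtB : circle (m + t) B !=set0)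
    (axis : exists x y : nat,
      [/\ is_axis (m + t) M (Point x) (Point y), B x, x < y &
        exists w : nat,
          [/\ is_max [set u | weights (circle m M) u /\ B u] w,
              w < y & (m%:Z - x%:Z < w%:Z)%R]]) :
  exists s : nat, [/\ posN s, m < s, s < m + t & circle s B !=set0].
Proof.
case: axis => x [y [[_ _ /= xy_eq] Bx _ [w [[[_ Bw] _] w_lt_y m_lt]]]].
have m_lt_s : m < x + w by lia.
exists (x + w); split=> //.
- exact: leq_ltn_trans m_lt_s.
- by rewrite -xy_eq ltn_add2l.
- exact: circle_add_nonempty.
Qed.
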